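(* Let $G=(V,E)$ and $G'=(V,E')$ be undirected graphs on the same finite vertex set $V$, in which every vertex has at least one neighbour, and let $\delta=(E\setminus E')\cup(E'\setminus E)$ be the set of inserted and deleted edges. Let $A\subseteq V$ be the set of endpoints of edges in $\delta$. Consider a random walk model of order at most two: for a graph $H$, a walk $(v_0,\dots,v_{l-1})$ started at a fixed vertex $v_0$ is generated by drawing $v_1$ from a distribution $P_H(\cdot\mid v_0)$ and, for $j\ge 1$, $v_{j+1}$ from $P_H(\cdot\mid v_{j-1},v_j)$, where $P_H(\cdot\mid v_0)$ depends on $H$ only through $N_H(v_0)$ and $P_H(\cdot\mid t,v)$ depends on $H$ only through $N_H(t)$ and $N_H(v)$ (for instance DeepWalk: uniform over $N_H(v)$; or node2vec). Let $\mathcal{W}=(w_1,\dots,w_m)$ be a walk corpus on $G$, i.e.\ independent walks of length $l$ generated on $G$ from prescribed start vertices. Form $\mathcal{W}'$ as follows: for each walk $w_i=(v_0,\dots,v_{l-1})$, if no $v_j$ lies in $A$ keep $w_i$ unchanged; otherwise let $p_{\min}$ be the least $j$ with $v_j\in A$, keep $v_0,\dots,v_{p_{\min}}$ and resample $v_{p_{\min}+1},\dots,v_{l-1}$ sequentially according to the model on $G'$ (independently across walks). Then $\mathcal{W}'$ has the same joint distribution as a walk corpus generated from scratch on $G'$ from the same start vertices; i.e.\ $\mathcal{W}'$ is statistically indistinguishable.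
   Context: $N_H(v)$ denotes the set of neighbours of $v$ in $H$. A walk corpus is a collection of random walks; ''statistically indistinguishable'' means that the corpus obtained by updating an existing corpus after a graph update is equi-probable (has the same distribution) as a corpus generated from scratch on the updated graph. *)

(* Defs.v *)
From HB Require Import structures.
From mathcomp Require Import all_boot all_order all_algebra.
Set Implicit Arguments. Unset Strict Implicit. Unset Printing Implicit Defensive.
Import Order.TTheory GRing.Theory Num.Theory.
Local Open Scope ring_scope.

Section Walks.
Variables (R : realFieldType) (V : finType).

Definition undirected (E : rel V) : Prop := symmetric E /\ irreflexive E.

Definition no_isolated (E : rel V) : Prop := forall v, exists u, E v u.

Definition nbhd (E : rel V) (v : V) : {set V} := [set u | E v u].

Definition changed_endpoints (E E' : rel V) : {set V} :=
  [set v | [exists u, E v u != E' v u]].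

(* A second-order walk model: first step kernel p1 (N(v0)) v0 x  = P(x | v0),
   later steps kernel p2 (N(t)) (N(v)) t v x = P(x | t, v). The dependence on
   the graph is only through the neighbourhood sets. *)
Definition kernel1 := {set V} -> V -> V -> R.
Definition kernel2 := {set V} -> {set V} -> V -> V -> V -> R.

Definition model_ok (p1 : kernel1) (p2 : kernel2) (E : rel V) : Prop :=
  (forall v x, 0 <= p1 (nbhd E v) v x) /\
  (forall v, \sum_x p1 (nbhd E v) v x = 1) /\
  (forall t v x, 0 <= p2 (nbhd E t) (nbhd E v) t v x) /\
  (forall t v, \sum_x p2 (nbhd E t) (nbhd E v) t v x = 1).

Variables (p1 : kernel1) (p2 : kernel2).

Fixpoint steps (E : rel V) (t v : V) (s : seq V) : R :=
  match s with
  | [::] => 1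
  | x :: s' => p2 (nbhd E t) (nbhd E v) t v x * steps E v x s'
  end.

Definition cont (E : rel V) (pre suf : seq V) : R :=
  match rev pre with
  | [::] => 0
  | [:: v] => match suf with
              | [::] => 1
              | x :: s' => p1 (nbhd E v) v x * steps E v x s'
              end
  | v :: t :: _ => steps E t v suf
  end.

Definition walk_prob (E : rel V) (s : V) (w : seq V) : R :=
  match w with
  | [::] => 0
  | v0 :: r => (v0 == s)%:R * cont E [:: v0] r
  end.

Definition update_prob (E' : rel V) (A : {set V}) (w w' : seq V) : R :=
  if has (mem A) w then
    let p := find (mem A) w in
    (take p.+1 w' == take p.+1 w)%:R * cont E' (take p.+1 w) (drop p.+1 w')
  else (w' == w)%:R.

Definition corpus_prob (E : rel V) (m l : nat) (st : 'I_m -> V)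
    (W : {ffun 'I_m -> l.-tuple V}) : R :=
  \prod_(i < m) walk_prob E (st i) (W i).

Definition updated_corpus_prob (E E' : rel V) (m l : nat) (st : 'I_m -> V)
    (W' : {ffun 'I_m -> l.-tuple V}) : R :=
  \sum_(W : {ffun 'I_m -> l.-tuple V})
     corpus_prob E st W *
     \prod_(i < m) update_prob E' (changed_endpoints E E') (W i) (W' i).

End Walks.

(* Main.v *)
Require Import Defs.
From HB Require Import structures.
From mathcomp Require Import all_boot all_order all_algebra.
Import Order.TTheory GRing.Theory Num.Theory.
Local Open Scope ring_scope.

(** The kernels of [G] and [G'] agree at vertices outside [A].  Up to and
    including the first visit to [A], a walk on [G] therefore has the same law
    as a walk on [G'], and the resampled part of the old walk integrates to 1.
    Conditioning on the first vertex turns this into an induction on the number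
    of remaining steps; independence of the walks then exchanges the product
    over the corpus with the sum over old corpora. *)

Lemma big_tuple0 (R : nmodType) (V : finType) (F : 0.-tuple V -> R) :
  \sum_w F w = F [tuple].
Proof. by apply: big_pred1 => w; apply/esym/eqP/tuple0. Qed.

Lemma big_tupleS (R : nmodType) (V : finType) (n : nat) (F : n.+1.-tuple V -> R) :
  \sum_w F w = \sum_x \sum_(w : n.-tuple V) F (cons_tuple x w).
Proof.
rewrite pair_big /=.
rewrite (reindex (fun p : V * n.-tuple V => cons_tuple p.1 p.2)) //=.
exists (fun w : n.+1.-tuple V => (thead w, behead_tuple w)).
- by case=> x w _ /=; congr (_, _); apply: val_inj.
- by move=> w _; rewrite [RHS]tuple_eta; apply: val_inj.
Qed.

Lemma sum_pred1_mul (R : pzSemiRingType) (V : finType) (y : V) (F : V -> R) :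
  \sum_x (y == x)%:R * F x = F y.
Proof.
rewrite (bigD1 y) //= eqxx mul1r big1 ?addr0 // => x /negbTE.
by rewrite eq_sym => ->; rewrite mul0r.
Qed.

Section Update.
Local Set Implicit Arguments.
Local Unset Strict Implicit.
Context {R : realFieldType} {V : finType}.
Variables (p1 : kernel1 R V) (p2 : kernel2 R V).
Implicit Types (E : rel V) (A : {set V}) (pre w : seq V).

Lemma nbhd_unchanged E E' v :
  v \notin changed_endpoints E E' -> nbhd E v = nbhd E' v.
Proof.
rewrite inE negb_exists => /forallP h; apply/setP => u; rewrite !inE.
by apply/eqP; rewrite -[_ == _]negbK h.
Qed.

Lemma cont_nil E pre : pre != [::] -> cont p1 p2 E pre [::] = 1.
Proof.
case/lastP: pre => // pre v _; rewrite /cont rev_rcons.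
by case: (rev pre).
Qed.

(** Chain rule: a step looks back at most two vertices, so after [x] is drawn only the last vertex
    of [pre] and [x] matter. For empty [pre] the default value 0 makes both sides vanish. *)
Lemma cont_cons E pre x w :
  cont p1 p2 E pre (x :: w) =
  cont p1 p2 E pre [:: x] * cont p1 p2 E (rcons pre x) w.
Proof.
rewrite /cont rev_rcons; case: (rev pre) => [|v [|t q]] /=.
- by rewrite mul0r.
- by rewrite mulr1.
- by rewrite mulr1.
Qed.

Lemma sum_cont1 E pre :
  model_ok p1 p2 E -> pre != [::] -> \sum_x cont p1 p2 E pre [:: x] = 1.
Proof.
move=> [_ [s1 [_ s2]]]; case/lastP: pre => // pre v _.
rewrite /cont rev_rcons; case: (rev pre) => [|t q] /=.
- by under eq_bigr do rewrite mulr1.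
- by under eq_bigr do rewrite mulr1.
Qed.

(** One step reads only the neighbourhoods of the last one or two vertices of [pre], which are the
    same in both graphs. *)
Lemma cont1_unchanged E E' pre x :
  all [predC changed_endpoints E E'] pre ->
  cont p1 p2 E pre [:: x] = cont p1 p2 E' pre [:: x].
Proof.
rewrite -all_rev /cont; case: (rev pre) => [|v [|t q]] //=.
- by rewrite andbT => /nbhd_unchanged ->.
- by case/and3P => /nbhd_unchanged -> /nbhd_unchanged ->.
Qed.

Lemma rcons_neq_nil pre x : rcons pre x != [::].
Proof. by case: pre. Qed.

Lemma sum_cont E n pre :
  model_ok p1 p2 E -> pre != [::] ->
  \sum_(w : n.-tuple V) cont p1 p2 E pre w = 1.
Proof.
move=> okE; elim: n pre => [|n IHn] pre pre0.
  by rewrite big_tuple0 cont_nil.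
rewrite big_tupleS -[RHS](sum_cont1 okE pre0); apply: eq_bigr => x _.
under eq_bigr do rewrite /= cont_cons.
by rewrite -big_distrr /= IHn ?rcons_neq_nil // mulr1.
Qed.

(* [update_prob] relative to an already generated common prefix [pre]. *)
Definition update_prob_after E' A pre w w' : R :=
  if has (mem A) w then
    let p := find (mem A) w in
    (take p.+1 w' == take p.+1 w)%:R
    * cont p1 p2 E' (pre ++ take p.+1 w) (drop p.+1 w')
  else (w' == w)%:R.

(** If [x] lies in [A], the first visit has index 0 and all that follows is resampled; otherwise the
    index drops by one in [w] and [x] joins the prefix. *)
Lemma update_prob_after_cons E' A pre x w x' w' :
  update_prob_after E' A pre (x :: w) (x' :: w') =
  (x' == x)%:R * (if x \in A then cont p1 p2 E' (rcons pre x) w'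
                  else update_prob_after E' A (rcons pre x) w w').
Proof.
rewrite /update_prob_after /=; case: (boolP (x \in A)) => xA /=.
  by rewrite take0 take0 drop0 eqseq_cons eqxx andbT cats1.
rewrite !eqseq_cons; case: ifP => _; last by rewrite -natrM mulnb.
by rewrite -cat_rcons mulrA -natrM mulnb.
Qed.

(** The prefix is general so that the induction can lengthen it for as long as it avoids the changed
    endpoints. *)
Lemma sum_cont_update E E' n pre (w' : n.-tuple V) :
  model_ok p1 p2 E -> pre != [::] ->
  all [predC changed_endpoints E E'] pre ->
  \sum_(w : n.-tuple V)
     cont p1 p2 E pre w * update_prob_after E' (changed_endpoints E E') pre w w'
  = cont p1 p2 E' pre w'.
Proof.
move=> okE; elim: n pre w' => [|n IHn] pre w' pre0 preA.
  by rewrite big_tuple0 (tuple0 w') /update_prob_after /= !cont_nil // mul1r.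
case/tupleP: w' => x' w'; rewrite big_tupleS /=.
under eq_bigr => x _.
  under eq_bigr do rewrite /= cont_cons update_prob_after_cons mulrCA.
  rewrite -big_distrr /=; over.
(* The indicator forces the old next vertex to be [x'], and its step probability is common to both
   graphs, hence cancels. *)
rewrite sum_pred1_mul (cont_cons E') -(cont1_unchanged x' preA).
under eq_bigr do rewrite -mulrA.
rewrite -big_distrr /=; congr (_ * _); case: (boolP (x' \in _)) => x'A.
  (* Resampling starts here: the new suffix no longer depends on the old one, which sums to 1. *)
  by rewrite -big_distrl /= sum_cont ?rcons_neq_nil // mul1r.
by rewrite IHn ?rcons_neq_nil // all_rcons /= x'A.
Qed.

Lemma sum_walk_update E E' l s (w' : l.-tuple V) :
  model_ok p1 p2 E -> (0 < l)%N ->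
  \sum_(w : l.-tuple V)
     walk_prob p1 p2 E s w * update_prob p1 p2 E' (changed_endpoints E E') w w'
  = walk_prob p1 p2 E' s w'.
Proof.
move=> okE; case: l w' => // n w' _.
case/tupleP: w' => x' w'; rewrite big_tupleS /=.
under eq_bigr => x _.
  under eq_bigr => w _.
    (* The empty prefix recovers [update_prob] by conversion; the start vertex is peeled off
       separately, since [cont] is 0 on an empty prefix. *)
    rewrite -[update_prob _ _ _ _ _ _]/(update_prob_after E' _ [::] (x :: w) (x' :: w')).
    rewrite update_prob_after_cons mulrCA; over.
  rewrite -big_distrr /=; over.
rewrite sum_pred1_mul; under eq_bigr do rewrite -mulrA.
rewrite -big_distrr /=; congr (_ * _); case: (boolP (x' \in _)) => x'A.
  by rewrite -big_distrl /= sum_cont // mul1r.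
by rewrite sum_cont_update //= x'A.
Qed.

End Update.

Theorem mainTheorem4 (R : realFieldType) (V : finType) (E E' : rel V)
  (p1 : kernel1 R V) (p2 : kernel2 R V) (m l : nat) (st : 'I_m -> V) :
  undirected E -> undirected E' ->
  no_isolated E -> no_isolated E' ->
  model_ok p1 p2 E -> model_ok p1 p2 E' ->
  (0 < l)%N ->
  forall W' : {ffun 'I_m -> l.-tuple V},
    updated_corpus_prob p1 p2 E E' st W' = corpus_prob p1 p2 E' st W'.
Proof.
move=> _ _ _ _ okE _ l_gt0 W'; rewrite /updated_corpus_prob /corpus_prob.
under eq_bigr do rewrite -big_split /=.
(* A sum over all corpora of a product over walks is a product of single-walk sums. *)
rewrite -(bigA_distr_bigA (fun i (w : l.-tuple V) => walk_prob p1 p2 E (st i) w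
  * update_prob p1 p2 E' (changed_endpoints E E') w (W' i))) /=.
by apply: eq_bigr => i _; apply: sum_walk_update.
Qed.
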